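(* Let $(X,\tau)$ be a metrizable space, $a\in X$, $\sigma\in\mathcal L^m_a(\tau)$, and let $s\in\mathcal G_a(\tau)$ represent $\sigma$, i.e. $\tau_s=\sigma$. The following are equivalent: (i) $\sigma\subsetneq\tau$; (ii) some $\tau$-open neighborhood $U$ of $a$ satisfies $\inf_{x\in X\setminus U}s(x)=0$; (iii) there is a countably infinite $\tau$-closed discrete set $D=\{x_n:n\in\mathbb N\}\subseteq X\setminus\{a\}$ with $x_n\to a$ in $\sigma$. Moreover, for any metric $d_0$ compatible with $\tau$, condition (ii) is equivalent to the existence of $r>0$ such that $$\inf\{s(x):x\in X,\ d_0(x,a)\ge r\}=0.$$ Here the infimum of the empty set is understood to be $+\infty$.
   Context: $X$ is a nonempty set and $\mathbb N=\{1,2,\ldots\}$. $\mathcal L^m_a(\tau)$ denotes the set of all metrizable topologies $\sigma$ on $X$ with $\sigma\subseteq\tau$ and $\sigma|_{X\setminus\{a\}}=\tau|_{X\setminus\{a\}}$ (equality of subspace topologies). $\mathcal G_a(\tau)$ denotes the set of $\tau$-continuous functions $s:X\to[0,\infty)$ with $s^{-1}(0)=\{a\}$. For $s\in\mathcal G_a(\tau)$, $\tau_s$ denotes the topology induced by the metric $\rho_s(x,y)=|s(x)-s(y)|+\min\{s(x),s(y)\}d(x,y)$, where $d\le1$ is any metric inducing $\tau$; it does not depend on the choice of such $d$. A metric is compatible with a topology if it induces it. A set is closed discrete if it is closed in the ambient space and has the discrete subspace topology. Enumerations $\{x_n:n\in\mathbb N\}$ of countably infinite closed discrete sets are without repetitions.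 *)

(* Defs.v *)
From HB Require Import structures.
From mathcomp Require Import all_boot all_order all_algebra.
From mathcomp Require Import all_classical all_reals all_analysis.
From mathcomp Require Import ring lra.

Set Implicit Arguments.
Unset Strict Implicit.
Unset Printing Implicit Defensive.

Import Order.TTheory GRing.Theory Num.Theory.
Import numFieldNormedType.Exports.

Local Open Scope classical_set_scope.
Local Open Scope ring_scope.

(* Several topologies and metrics live on one carrier here, so a metric is a
   function and a topology other than the canonical one of a [topologicalType]
   is its set of open sets. *)

Record is_metric (R : realType) (X : Type) (d : X -> X -> R) : Prop := {
  metric_ge0 : forall x y, 0 <= d x y;
  metric_eq0 : forall x y, d x y = 0 <-> x = y;
  metric_sym : forall x y, d x y = d y x;
  metric_triangle : forall x y z, d x z <= d x y + d y z }.

Definition metric_topology (R : realType) (X : Type) (d : X -> X -> R) :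
    set_system X :=
  [set U | forall x, U x -> exists2 e : R, 0 < e & [set y | d x y < e] `<=` U].

Definition compatible (R : realType) (X : Type) (d : X -> X -> R)
    (T : set_system X) : Prop :=
  is_metric d /\ metric_topology d = T.

Definition metrizable (R : realType) (X : Type) (T : set_system X) : Prop :=
  exists d : X -> X -> R, compatible d T.

Definition subspace_top (X : Type) (T : set_system X) (A : set X) :
    set_system X :=
  [set U `&` A | U in T].

Definition closed_discrete (X : topologicalType) (D : set X) : Prop :=
  closed D /\ subspace_top open D = [set B | B `<=` D].

Definition cvg_in (X : Type) (T : set_system X) (x : nat -> X) (l : X) : Prop :=
  forall U, T U -> U l -> \forall n \near \oo, U (x n).

(* L^m_a(tau), where tau is the canonical topology of X. *)
Definition Lm (R : realType) (X : topologicalType) (a : X) :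
    set (set_system X) :=
  [set T | [/\ metrizable R T, T `<=` open &
              subspace_top T (~` [set a]) = subspace_top open (~` [set a])]].

(* G_a(tau) *)
Definition Ga (R : realType) (X : topologicalType) (a : X) : set (X -> R) :=
  [set s : X -> R | [/\ continuous s, forall x, 0 <= s x &
     s @^-1` [set 0] = [set a]]].

Definition rho (R : realType) (X : Type) (s : X -> R) (d : X -> X -> R)
    (x y : X) : R :=
  `|s x - s y| + Num.min (s x) (s y) * d x y.

(* tau_s; by [tau_sE], any single admissible d gives the same open sets. *)
Definition tau_ (R : realType) (X : topologicalType) (s : X -> R) :
    set_system X :=
  [set U | exists d : X -> X -> R,
     [/\ compatible d open, forall x y, d x y <= 1 &
         metric_topology (rho s d) U]].

Lemma metric_topology_ball (R : realType) (X : Type) (d : X -> X -> R)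
    (x : X) (e : R) :
  is_metric d -> metric_topology d [set y | d x y < e].
Proof.
move=> md y /= xye; exists (e - d x y); first by rewrite subr_gt0.
move=> z /= yz; have := metric_triangle md x y z; lra.
Qed.

Lemma rho_topology_sub (R : realType) (X : Type) (s : X -> R)
    (d d' : X -> X -> R) :
  (forall x, 0 <= s x) -> is_metric d -> is_metric d' ->
  metric_topology d = metric_topology d' ->
  metric_topology (rho s d) `<=` metric_topology (rho s d').
Proof.
move=> s0 md md' dd' U Uo x Ux.
have [e e0 eU] := Uo x Ux.
have := s0 x; rewrite le_eqVlt => /orP[/eqP sx0|sx].
  exists e => // y /= xy; apply: eU; move: xy.
  by rewrite /rho /= -sx0 (min_idPl _) ?mul0r.
have k0 : 0 < e / (2 * s x) by rewrite divr_gt0 ?mulr_gt0.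
have /= := metric_topology_ball (x := x) (e := e / (2 * s x)) md.
rewrite dd' => /(_ x) /=; rewrite (metric_eq0 md x x).2// => /(_ k0).
move=> [r r0 rk].
have sx2 : 0 < s x / 2 by rewrite divr_gt0.
exists (Num.min (e / 2) (Num.min (s x / 2) (s x / 2 * r))).
  by rewrite !lt_min (mulr_gt0 sx2 r0) sx2 divr_gt0.
move=> y /=; rewrite !lt_min => /and3P[h1 h2 h3]; apply: eU => /=.
have m0 : 0 <= Num.min (s x) (s y) by rewrite le_min !s0.
have p' : 0 <= Num.min (s x) (s y) * d' x y.
  by rewrite mulr_ge0 // (metric_ge0 md').
have sd : `|s x - s y| < s x / 2 by move: h2; rewrite /rho; lra.
have sm : s x / 2 <= Num.min (s x) (s y).
  by move: sd; rewrite ltr_norml le_min => /andP[_ ?]; apply/andP; split; lra.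
have dr : d' x y < r.
  rewrite -(ltr_pM2l sx2); apply: le_lt_trans h3.
  apply: (le_trans (ler_wpM2r (metric_ge0 md' x y) sm)).
  by rewrite /rho lerDr.
have /= dk := rk y dr.
have mx : Num.min (s x) (s y) * d x y < e / 2.
  apply: (@le_lt_trans _ _ (s x * d x y)).
    by rewrite ler_wpM2r ?(metric_ge0 md) // ge_min lexx.
  have -> : e / 2 = s x * (e / (2 * s x)).
    by field; rewrite gt_eqF.
  by rewrite ltr_pM2l.
by move: h1 p'; rewrite /rho; lra.
Qed.

Lemma tau_sE (R : realType) (X : topologicalType) (s : X -> R)
    (d : X -> X -> R) :
  (forall x, 0 <= s x) -> compatible d open -> (forall x y, d x y <= 1) ->
  tau_ s = metric_topology (rho s d).
Proof.
move=> s0 [md dE] d1; apply/seteqP; split=> U; last by exists d.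
by move=> [d' [[md' d'E] _]]; apply: rho_topology_sub => //; rewrite d'E dE.
Qed.

(* Main.v *)
Require Import Defs.
From HB Require Import structures.
From mathcomp Require Import all_boot all_order all_algebra.
From mathcomp Require Import all_classical all_reals all_analysis.
From mathcomp Require Import lra.

(** Near [a] the metric [rho s d] only sees [s]: since [s a = 0], it gives
    [rho s d a y = s y], so the sets [[set y | s y < e]] are a neighbourhood
    base at [a] for [tau_ s], while away from [a] the topologies [tau_ s] and
    [open] agree. Hence [tau_ s] can only be strictly coarser than [open] by
    losing neighbourhoods of [a], and an open neighbourhood [U] of [a] is lost
    exactly when [s] takes arbitrarily small values outside [U]
    ([tau_sublevel], [tau_of_sublevel]).

    In that case one picks points outside [U] along which [s] decreases
    strictly to [0] ([small_sequence]). They converge to [a] in [tau_ s], yet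
    for the original topology they are closed discrete: [U] keeps them away from
    [a], and by continuity of [s] any other point [y] has a neighbourhood where
    [s > s y / 2], which contains finitely many of them
    ([vanishing_set_closed]). Conversely, if a closed set [D] misses [a] but
    contains a sequence converging to [a] in [tau_ s], then its complement is
    an open set containing [a] that cannot belong to [tau_ s].

    For the metric form of the second condition, [U] is shrunk to a ball: small
    values of [s] outside [U] are also values outside a ball inside [U]. *)

Set Implicit Arguments.
Unset Strict Implicit.
Unset Printing Implicit Defensive.

Import Order.TTheory GRing.Theory Num.Theory.
Import numFieldNormedType.Exports.

Local Open Scope classical_set_scope.
Local Open Scope ring_scope.

Lemma ereal_inf_eq0P (R : realType) (X : Type) (s : X -> R) (A : set X) :
  (forall x, 0 <= s x) ->
  ereal_inf [set (s x)%:E | x in A] = 0%E <->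
  forall e : R, 0 < e -> exists2 x, A x & s x < e.
Proof.
move=> s0; split=> [inf0 e e0|small].
  have /ereal_inf_lt[_ [x Ax <-]] : (ereal_inf [set (s x)%:E | x in A] < e%:E)%E.
    by rewrite inf0 lte_fin.
  by rewrite lte_fin => sxe; exists x.
apply/eqP; rewrite eq_le; apply/andP; split; last first.
  by apply: le_ereal_inf_tmp => _ [x _ <-]; rewrite lee_fin.
apply/lee_addgt0Pr => e e0; rewrite add0e.
have [x Ax sxe] := small e e0.
apply: (@le_trans _ _ (s x)%:E); last by rewrite lee_fin ltW.
by apply: ereal_inf_lbound; exists x.
Qed.

Lemma compatible_accessible (R : realType) (X : topologicalType)
    (d : X -> X -> R) : compatible d open -> accessible_space X.
Proof.
move=> [md dE] x y xy; exists [set z | d x z < d x y]; split.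
- by rewrite -dE; apply: metric_topology_ball.
- rewrite inE /= (metric_eq0 md x x).2// lt_neqAle (metric_ge0 md) andbT.
  by apply/eqP => /esym/(metric_eq0 md x y); apply/eqP.
- by rewrite inE /= ltxx.
Qed.

Lemma locally_finite_closed (X : topologicalType) (E : set X) :
  accessible_space X ->
  (forall y : X, exists2 W : set X, nbhs y W & finite_set (W `&` E)) -> closed E.
Proof.
move=> X1 Efin y Ey; have [W Wy WEfin] := Efin y.
have [fin_closed _] := @accessible_finite_set_closed X.
suff [] : (W `&` E) y by [].
apply: (fin_closed X1 _ WEfin).
move=> Z Zy; have [z [Ez [Wz Zz]]] := Ey (W `&` Z) (filterI Wy Zy).
by exists z.
Qed.

Lemma closed_discrete_hereditary (X : topologicalType) (D : set X) :
  (forall B, B `<=` D -> closed B) -> closed_discrete D.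
Proof.
move=> clB; split; first exact: clB.
apply/seteqP; split=> [_ [U _ <-] x []//|B BD].
exists (~` (D `\` B)); first by apply: closed_openC; apply: clB => x [].
apply/seteqP; split=> [x [/not_andP[//|/contrapT//] Dx]|x Bx].
by split; [case|exact: BD].
Qed.

(** By continuity of [s], a point [y] other than [a] has the neighbourhood
    [[set x | s y / 2 < s x]], which meets [E] in a finite set. *)
Lemma vanishing_set_closed (R : realType) (X : topologicalType) (a : X)
    (s : X -> R) (E : set X) :
  accessible_space X -> continuous s -> (forall x, x <> a -> 0 < s x) ->
  nbhs a (~` E) ->
  (forall e : R, 0 < e -> finite_set ([set x | e < s x] `&` E)) -> closed E.
Proof.
move=> X1 cs s_gt0 aE fin; apply: locally_finite_closed => // y.
have [->|ya] := pselect (y = a); first by exists (~` E); rewrite // setICl.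
have sy := s_gt0 _ ya.
exists [set x | s y / 2 < s x]; last by apply: fin; rewrite divr_gt0.
by apply: (cs y [set r | s y / 2 < r]); apply: lt_nbhsr; lra.
Qed.

(** Strict decrease of [s] along the sequence makes it injective; the explicit
    rate [n.+1%:R^-1] makes each set [[set y | e < s y]] contain finitely many
    of its terms. *)
Lemma small_sequence (R : realType) (X : Type) (s : X -> R) (A : set X) :
  (forall x, A x -> 0 < s x) ->
  (forall e : R, 0 < e -> exists2 x, A x & s x < e) ->
  exists x : nat -> X, [/\ forall n, A (x n),
    {homo (s \o x) : m n / (m < n)%N >-> n < m} &
    forall n, s (x n) < n.+1%:R^-1].
Proof.
move=> s_gt0 small.
have /choice[f fP] (e : R) : exists x, 0 < e -> A x /\ s x < e.
  have [e0|_] := ltP 0 e; first by have [x Ax sx] := small e e0; exists x.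
  by have [x _ _] := small 1 ltr01; exists x.
pose x := fix x n :=
  if n is m.+1 then f (Num.min (s (x m)) m.+2%:R^-1) else f 1.
have Ax n : A (x n).
  elim: n => [|n /s_gt0 sn]; first exact: (fP _ ltr01).1.
  by apply: (fP _ _).1; rewrite lt_min sn invr_gt0 ltr0n.
have xS n : s (x n.+1) < Num.min (s (x n)) n.+2%:R^-1.
  by apply: (fP _ _).2; rewrite lt_min s_gt0//= invr_gt0 ltr0n.
exists x; split=> //.
  apply: homo_ltn => [u v w|n] /=; first by move=> uv vw; apply: lt_trans uv.
  by have := xS n; rewrite lt_min => /andP[].
case=> [|n]; first by rewrite invr1; exact: (fP _ ltr01).2.
by have := xS n; rewrite lt_min => /andP[].
Qed.

Lemma rho_zerol (R : realType) (X : Type) (s : X -> R) (d : X -> X -> R)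
    (a y : X) :
  (forall x, 0 <= s x) -> s a = 0 -> rho s d a y = s y.
Proof.
by move=> s0 sa; rewrite /rho sa min_l// mul0r addr0 sub0r normrN ger0_norm.
Qed.

(** The [rho s d]-balls around a zero of [s] are sublevel sets of [s], whichever
    metric [d] is used. *)
Lemma tau_sublevel (R : realType) (X : topologicalType) (s : X -> R) (a : X)
    (U : set X) :
  (forall x, 0 <= s x) -> s a = 0 -> tau_ s U -> U a ->
  exists2 e : R, 0 < e & [set y | s y < e] `<=` U.
Proof.
move=> s0 sa [d [_ _ Uo]] /Uo[e e0 eU]; exists e => // y ye.
by apply: eU; rewrite /= rho_zerol.
Qed.

(** Away from [a] it suffices to shrink the [rho s d]-ball around [x] to radius
    [s x], since this excludes [a]. *)
Lemma tau_of_sublevel (R : realType) (X : topologicalType) (s : X -> R) (a : X)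
    (U V : set X) :
  (forall x, 0 <= s x) -> s a = 0 -> (forall x, x <> a -> 0 < s x) ->
  tau_ s V -> V `&` ~` [set a] = U `&` ~` [set a] ->
  (U a -> exists2 e : R, 0 < e & [set y | s y < e] `<=` U) -> tau_ s U.
Proof.
move=> s0 sa s_gt0 [d [dc d1 Vo]] VU sublevelU.
exists d; split=> // x Ux; have [xa|xa] := pselect (x = a).
  move: Ux; rewrite xa => /sublevelU[e e0 eU].
  by exists e => // y /=; rewrite rho_zerol//; apply: eU.
have [Vx _] : (V `&` ~` [set a]) x by rewrite VU.
have [r r0 rV] := Vo x Vx; exists (Num.min r (s x)).
  by rewrite lt_min r0 s_gt0.
move=> y /=; rewrite lt_min => /andP[yr yx].
suff [] : (U `&` ~` [set a]) y by [].
rewrite -VU; split; first exact: rV.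
move=> ya; move: yx; rewrite ya /rho sa min_r// mul0r addr0 subr0.
by rewrite ger0_norm// ltxx.
Qed.

Theorem theorem4p3 (R : realType) (X : topologicalType) (a : X)
    (sigma : set_system X) (s : X -> R) :
  metrizable R (@open X) -> Lm R a sigma -> Ga a s -> tau_ s = sigma ->
  [<-> sigma `<` open;
       exists2 U : set X, open_nbhs a U &
         ereal_inf [set (s x)%:E | x in ~` U] = 0%E;
       exists (D : set X) (x : nat -> X),
         [/\ injective x, range x = D, closed_discrete D,
             D `<=` ~` [set a] & cvg_in sigma x a]] /\
  forall d0 : X -> X -> R, compatible d0 open ->
    (exists2 U : set X, open_nbhs a U &
       ereal_inf [set (s x)%:E | x in ~` U] = 0%E) <->
    (exists2 r : R, 0 < r &
       ereal_inf [set (s x)%:E | x in [set x | r <= d0 x a]] = 0%E).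
Proof.
move=> [d [md dE]] [_ sigma_sub sigmaD] [cs s0 s_eq0] tauE.
have sa : s a = 0 by have : (s @^-1` [set 0]) a by rewrite s_eq0.
have s_gt0 x : x <> a -> 0 < s x.
  move=> xa; rewrite lt_neqAle s0 andbT eq_sym; apply/eqP => sx; apply: xa.
  by have : (s @^-1` [set 0]) x by []; rewrite s_eq0.
have X1 : accessible_space X by apply: (@compatible_accessible _ _ d).
split; first tfae.
- move=> [_ /existsNP[U /not_implyP[Uo nU]]].
  have [V Vs VU] : subspace_top sigma (~` [set a]) (U `&` ~` [set a]).
    by rewrite sigmaD; exists U.
  rewrite -tauE in Vs nU.
  (* The only obstruction to [U] being open for [tau_ s] is at [a]. *)
  have noE : ~ (U a -> exists2 e : R, 0 < e & [set y | s y < e] `<=` U).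
    by move=> /(tau_of_sublevel s0 sa s_gt0 Vs VU).
  move/not_implyP: noE => [Ua noe].
  exists U; first by split.
  apply/(ereal_inf_eq0P _ s0) => e e0; apply: contrapT => nUe; apply: noe.
  by exists e => // y ye; apply: contrapT => nUy; apply: nUe; exists y.
- move=> [U [Uo Ua] /(ereal_inf_eq0P _ s0) small].
  have Us x : (~` U) x -> 0 < s x.
    by move=> nUx; apply: s_gt0 => xa; rewrite xa in nUx.
  have [x [xU xdecr xlt]] := small_sequence Us small.
  have xinj : injective x.
    move=> m n xmn; case: (ltngtP m n) => // /xdecr /=; rewrite xmn ltxx//.
  exists (range x), x; split=> //.
  + apply: closed_discrete_hereditary => B Bx.
    apply: (vanishing_set_closed X1 cs s_gt0).
      apply: (@filterS _ _ _ U); last exact: open_nbhs_nbhs.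
      by move=> y Uy /Bx[n _ xy]; apply: (xU n); rewrite xy.
    move=> e e0; have [N _ NP] := near_infty_natSinv_lt (PosNum e0).
    apply: (@sub_finite_set _ _ (x @` `I_N)); last exact/finite_image/finite_II.
    move=> y [/= ey /Bx[n _ xy]]; exists n => //=; rewrite ltnNge.
    apply/negP => /NP /(lt_trans (xlt n)) /=; rewrite xy => /(lt_trans ey).
    by rewrite ltxx.
  + by move=> _ [n _ <-] xa; apply: (xU n); rewrite xa.
  + move=> V; rewrite -tauE => Vs Va.
    have [e e0 eV] := tau_sublevel s0 sa Vs Va.
    have [N _ NP] := near_infty_natSinv_lt (PosNum e0).
    exists N => // n /NP /= ne; apply: eV => /=; exact: lt_trans ne.
- move=> [D [x [_ xD [Dcl _] Da xcvg]]]; split=> // sub.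
  have nDa : (~` D) a by move=> /Da; apply.
  have [N _ NP] := xcvg _ (sub _ (closed_openC Dcl)) nDa.
  by have := NP N (leqnn N); apply; rewrite -xD; exists N.
move=> d0 [md0 d0E]; split.
  move=> [U [Uo Ua] /(ereal_inf_eq0P _ s0) small].
  have [r r0 rU] : exists2 e : R, 0 < e & [set y | d0 a y < e] `<=` U.
    by move: Uo; rewrite -d0E; apply.
  exists r => //; apply/(ereal_inf_eq0P _ s0) => e /small[x nUx sx].
  exists x => //=; rewrite leNgt (Defs.metric_sym md0); apply/negP => /rU; exact: nUx.
move=> [r r0 inf0]; exists [set x | d0 a x < r].
  split; first by rewrite -d0E; apply: metric_topology_ball.
  by rewrite /= (metric_eq0 md0 a a).2.
rewrite -[RHS]inf0; congr (ereal_inf [set _ | x in _]).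
by apply/seteqP; split=> x /=; rewrite (Defs.metric_sym md0) leNgt => /negP.
Qed.
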